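(* Let $m$ and $n$ be non-negative integers and let $j$, $r$, $s$ be any integers. Then \[ \sum_{k = 0}^n \binom nk F_{j(2rk + s)}^{2m + 1} = \begin{cases} 5^{-m} \sum_{i = 0}^m (-1)^{i(js + 1)} \binom{2m + 1}{i} L_{(2m + 1 - 2i)jr}^n F_{(2m + 1 - 2i)(jrn + js)}, & jr \text{ even},\\ 5^{n/2 - m} \sum_{i = 0}^m (-1)^{i(js + 1)} \binom{2m + 1}{i} F_{(2m + 1 - 2i)jr}^n F_{(2m + 1 - 2i)(jrn + js)}, & jr \text{ odd},\ n \text{ even},\\ 5^{(n - 1)/2 - m} \sum_{i = 0}^m (-1)^{i(js + 1)} \binom{2m + 1}{i} F_{(2m + 1 - 2i)jr}^n L_{(2m + 1 - 2i)(jrn + js)}, & jr \text{ odd},\ n \text{ odd}, \end{cases} \] and \[ \sum_{k = 0}^n \binom nk L_{j(2rk + s)}^{2m + 1} = \begin{cases} \sum_{i = 0}^m (-1)^{ijs} \binom{2m + 1}{i} L_{(2m + 1 - 2i)jr}^n L_{(2m + 1 - 2i)(jrn + js)}, & jr \text{ even},\\ 5^{n/2} \sum_{i = 0}^m (-1)^{ijs} \binom{2m + 1}{i} F_{(2m + 1 - 2i)jr}^n L_{(2m + 1 - 2i)(jrn + js)}, & jr \text{ odd},\ n \text{ even},\\ 5^{(n + 1)/2} \sum_{i = 0}^m (-1)^{ijs} \binom{2m + 1}{i} F_{(2m + 1 - 2i)jr}^n F_{(2m + 1 - 2i)(jrn + js)}, & jr \text{ odd},\ n \text{ odd}. \end{cases}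 \]
   Context: The Fibonacci numbers $F_n$ and Lucas numbers $L_n$ are defined for all integers $n$ by $F_0=0$, $F_1=1$, $L_0=2$, $L_1=1$, $F_n=F_{n-1}+F_{n-2}$, $L_n=L_{n-1}+L_{n-2}$, extended to negative indices by $F_{-n}=(-1)^{n-1}F_n$, $L_{-n}=(-1)^nL_n$. The convention $0^0=1$ is used. *)

(* Defs.v *)
From mathcomp Require Import all_boot all_order all_algebra.

Set Implicit Arguments.
Unset Strict Implicit.
Unset Printing Implicit Defensive.

Import GRing.Theory.
Local Open Scope ring_scope.

Fixpoint fib_nat (n : nat) : int :=
  match n with
  | 0%N => 0
  | 1%N => 1
  | (n2.+1 as n1).+1 => fib_nat n1 + fib_nat n2
  end.

Fixpoint lucas_nat (n : nat) : int :=
  match n with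
  | 0%N => 2
  | 1%N => 1
  | (n2.+1 as n1).+1 => lucas_nat n1 + lucas_nat n2
  end.

(* [Negz k] is the integer -(k + 1), so the sign (-1)^(n-1) with n = k + 1
   in F_{-n} = (-1)^(n-1) F_n is (-1)^k. *)
Definition fib (n : int) : int :=
  match n with
  | Posz k => fib_nat k
  | Negz k => (-1) ^+ k * fib_nat k.+1
  end.

Definition lucas (n : int) : int :=
  match n with
  | Posz k => lucas_nat k
  | Negz k => (-1) ^+ k.+1 * lucas_nat k.+1
  end.

Lemma fibN (n : int) : fib (- n) = (-1) ^ (n - 1) * fib n.
Proof.
case: n => [[|k]|k].
- by rewrite oppr0 mulr0.
- have -> : k.+1%:Z - 1 = k%:Z by rewrite -addn1 PoszD addrK.
  by rewrite -NegzE.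
- have -> : Negz k - 1 = Negz k.+1 by rewrite !NegzE -opprD -PoszD addn1.
  rewrite {1}NegzE opprK -[_ ^ Negz _]/((-1) ^+ k.+2)^-1 -exprVn invrN1.
  rewrite /fib mulrA -exprD !addSn addnn -mul2n.
  by rewrite !exprSr exprM sqrrN !expr1n !mulrN1 opprK mul1r.
Qed.

Lemma lucasN (n : int) : lucas (- n) = (-1) ^ n * lucas n.
Proof.
case: n => [[|k]|k].
- by rewrite oppr0 mul1r.
- by rewrite -NegzE.
- rewrite {1}NegzE opprK -[_ ^ Negz _]/((-1) ^+ k.+1)^-1 -exprVn invrN1.
  by rewrite /lucas mulrA -exprD addnn -mul2n exprM sqrrN !expr1n mul1r.
Qed.

Lemma fib_rec (n : int) : fib n = fib (n - 1) + fib (n - 2).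
Proof.
case: n => [[|[|k]]|k] //.
- have -> : k.+2%:Z - 1 = k.+1 by rewrite -[k.+2]addn1 PoszD addrK.
  by have -> : k.+2%:Z - 2 = k by rewrite -[k.+2]addn2 PoszD addrK.
- have -> : Negz k - 1 = Negz k.+1 by rewrite !NegzE -opprD -PoszD addn1.
  have -> : Negz k - 2 = Negz k.+2 by rewrite !NegzE -opprD -PoszD addn2.
  rewrite -[fib (Negz k)]/((-1) ^+ k * _) -[fib (Negz k.+1)]/((-1) ^+ k.+1 * _).
  rewrite -[fib (Negz k.+2)]/((-1) ^+ k.+2 * (fib_nat k.+2 + fib_nat k.+1)).
  move: (fib_nat k.+1) (fib_nat k.+2) => a b.
  by rewrite !exprS !mulN1r opprK mulrDr mulNr addKr.
Qed.

Lemma lucas_rec (n : int) : lucas n = lucas (n - 1) + lucas (n - 2).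
Proof.
case: n => [[|[|k]]|k] //.
- have -> : k.+2%:Z - 1 = k.+1 by rewrite -[k.+2]addn1 PoszD addrK.
  by have -> : k.+2%:Z - 2 = k by rewrite -[k.+2]addn2 PoszD addrK.
- have -> : Negz k - 1 = Negz k.+1 by rewrite !NegzE -opprD -PoszD addn1.
  have -> : Negz k - 2 = Negz k.+2 by rewrite !NegzE -opprD -PoszD addn2.
  rewrite -[lucas (Negz k)]/((-1) ^+ k.+1 * _).
  rewrite -[lucas (Negz k.+1)]/((-1) ^+ k.+2 * _).
  rewrite -[lucas (Negz k.+2)]/((-1) ^+ k.+3 * (lucas_nat k.+2 + lucas_nat k.+1)).
  move: (lucas_nat k.+1) (lucas_nat k.+2) => a b.
  by rewrite !exprS !mulN1r !opprK mulrDr !mulNr addrA subrr add0r.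
Qed.

(* Main.v *)
Require Import Defs.
From mathcomp Require Import all_boot all_order all_algebra.
From mathcomp Require Import algC.
From mathcomp Require Import ring zify.

Local Open Scope ring_scope.
Import GRing.Theory Num.Theory.

(** By Binet, [F] and [L] are both of the form [phi ^ t + e * psi ^ t] with
    [e = -1] (up to the factor [sqrt 5]) or [e = 1].  Pairing the terms [i] and
    [2m+1-i] of the binomial expansion of its odd power and using
    [phi * psi = -1] gives a combination of the same expressions at
    [(2m+1-2i)t].  The sum over [k] is then the binomial theorem:
    [sum_k C(n,k) x^(2Nk+c) = x^(Nn+c) (x^N + x^-N)^n], where
    [phi^-N = (-1)^N psi^N], so the parity of [N] decides between [L_N^n]
    and [(sqrt 5 F_N)^n], and [d = (-1)^N] contributes the sign [d^n] to [e]. *)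

Lemma exprD_odd (R : comPzRingType) (x y : R) (m : nat) :
  (x + y) ^+ (2 * m + 1) =
  \sum_(i < m.+1) 'C(2 * m + 1, i)%:R * (x * y) ^+ i *
    (x ^+ (2 * m + 1 - 2 * i) + y ^+ (2 * m + 1 - 2 * i)).
Proof.
rewrite exprDn -(big_mkord xpredT
  (fun i => x ^+ (2 * m + 1 - i) * y ^+ i *+ 'C(2 * m + 1, i))).
rewrite (big_cat_nat (n := m.+1)) //=; last by lia.
(* The upper half is reversed and shifted to start at 0, so that its summand at [i] is the term of
   index [2m+1-i]. *)
rewrite [X in _ + X]big_nat_rev -{2}[m.+1]add0n big_addn.
have -> : ((2 * m + 1).+1 - m.+1 = m.+1)%N by lia.
rewrite -big_split big_mkord; apply: eq_bigr => -[i /= lt_im] _.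
have -> : (m.+1 + (2 * m + 1).+1 - (i + m.+1).+1 = 2 * m + 1 - i)%N by lia.
rewrite bin_sub ?subKn; try lia.
(* With [M] the difference of the two exponents, [x ^+ i * y ^+ i] factors out of both paired
   terms. *)
move: 'C(_, i) => c; set M := (2 * m + 1 - 2 * i)%N.
have -> : (2 * m + 1 - i = M + i)%N by rewrite /M; lia.
by rewrite -mulrnDl -[LHS]mulr_natl !exprD exprMn; ring.
Qed.

(** * Roots of the characteristic polynomial, and signs *)

(** The golden ratio; it and its conjugate are taken in [algC] because they need a square root of
    5. *)
Definition phi : algC := (1 + sqrtC 5) / 2.
Definition psi : algC := (1 - sqrtC 5) / 2.

Lemma sqrt5_neq0 : sqrtC 5 != 0 :> algC.
Proof. by rewrite sqrtC_eq0 pnatr_eq0. Qed.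

Lemma phi_psi : phi * psi = -1.
Proof.
have h : sqrtC 5 ^+ 2 = 5 :> algC := sqrtCK _.
by rewrite /phi /psi; field: h; rewrite ?pnatr_eq0.
Qed.

Lemma phi_sqr : phi ^+ 2 = phi + 1.
Proof.
have h : sqrtC 5 ^+ 2 = 5 :> algC := sqrtCK _.
by rewrite /phi; field: h; rewrite ?pnatr_eq0.
Qed.

Lemma psi_sqr : psi ^+ 2 = psi + 1.
Proof.
have h : sqrtC 5 ^+ 2 = 5 :> algC := sqrtCK _.
by rewrite /psi; field: h; rewrite ?pnatr_eq0.
Qed.

Lemma phi_neq0 : phi != 0.
Proof. by apply: contra_eq_neq phi_psi => ->; rewrite mul0r eq_sym oppr_eq0 oner_eq0. Qed.

Lemma psi_neq0 : psi != 0.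
Proof. by apply: contra_eq_neq phi_psi => ->; rewrite mulr0 eq_sym oppr_eq0 oner_eq0. Qed.

Lemma signz_sqr (F : fieldType) (t : int) : (-1) ^ t * (-1) ^ t = 1 :> F.
Proof. by rewrite -expfzMl mulrNN mulr1 exp1rz. Qed.

Lemma signz_evenD (F : fieldType) (t u : int) :
  (-1) ^ (2 * t + u) = (-1) ^ u :> F.
Proof.
have -> : 2 * t + u = t + t + u by ring.
by rewrite !expfzDr ?oppr_eq0 ?oner_eq0 // signz_sqr mul1r.
Qed.

Lemma signz_parity (F : fieldType) (t : int) :
  (-1) ^ t = (if (2 %| t)%Z then 1 else -1) :> F.
Proof.
rewrite [in LHS](divz_eq t 2) mulrC signz_evenD.
have [] : (t %% 2)%Z = 0 \/ (t %% 2)%Z = 1 by lia.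
- by move=> t0; rewrite t0 ifT //; lia.
- by move=> t1; rewrite t1 ifF ?expr1z //; lia.
Qed.

(* [binet (-1) t] is sqrt(5) F_t and [binet 1 t] is L_t. *)
Definition binet (e : algC) (t : int) : algC := phi ^ t + e * psi ^ t.

Lemma phiN (t : int) : phi ^ (- t) = (-1) ^ t * psi ^ t.
Proof.
have phiV : phi^-1 = -1 * psi.
  by apply: (mulfI phi_neq0); rewrite divff ?phi_neq0 // mulrCA phi_psi mulrNN mulr1.
by rewrite -exprz_inv phiV expfzMl.
Qed.

Lemma psiN (t : int) : psi ^ (- t) = (-1) ^ t * phi ^ t.
Proof.
have psiV : psi^-1 = -1 * phi.
  apply: (mulfI psi_neq0).
  by rewrite divff ?psi_neq0 // mulrCA [psi * phi]mulrC phi_psi mulrNN mulr1.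
by rewrite -exprz_inv psiV expfzMl.
Qed.

(** Negating the index swaps the powers of [phi] and [psi] up to the sign [(-1) ^ t]. This carries
    the Binet formulas to negative indices. *)
Lemma binetN (e : algC) (t : int) : e * e = 1 ->
  binet e (- t) = e * (-1) ^ t * binet e t.
Proof. by move=> ee; rewrite /binet phiN psiN; ring: ee. Qed.

Lemma binet_nat_rec (e : algC) (n : nat) :
  binet e n.+2 = binet e n.+1 + binet e n.
Proof.
by rewrite /binet -!exprnP !exprS; ring: phi_sqr psi_sqr.
Qed.

(** * Binet formulas at all integer indices *)

Lemma lucas_binet (t : int) : (lucas t)%:~R = binet 1 t.
Proof.
have lucas_nat_binet (n : nat) : (lucas_nat n)%:~R = binet 1 n.
  (* The recurrence has order two, so the induction carries two consecutive values. *)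
  have [] // : (lucas_nat n)%:~R = binet 1 n /\ (lucas_nat n.+1)%:~R = binet 1 n.+1.
  elim: n => [|n [IH1 IH2]]; last first.
    by split=> //; rewrite binet_nat_rec -IH1 -IH2 -intrD.
  rewrite /binet !expr0z !expr1z /phi /psi; split; first by rewrite mul1r.
  by rewrite /=; field.
case: t => n; first exact: lucas_nat_binet.
rewrite NegzE lucasN binetN ?mulr1 // mul1r rmorphM rmorphXz ?unitrN1 //.
by rewrite rmorphN1; congr (_ * _); exact: lucas_nat_binet.
Qed.

Lemma fib_binet (t : int) : (fib t)%:~R = binet (-1) t / sqrtC 5.
Proof.
have q0 := sqrt5_neq0; have NN1 : (-1) * (-1) = 1 :> algC by rewrite mulrNN mulr1.
have fib_nat_binet (n : nat) : (fib_nat n)%:~R = binet (-1) n / sqrtC 5.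
  have [] // : (fib_nat n)%:~R = binet (-1) n / sqrtC 5 /\
     (fib_nat n.+1)%:~R = binet (-1) n.+1 / sqrtC 5.
  elim: n => [|n [IH1 IH2]]; last first.
    by split=> //; rewrite binet_nat_rec mulrDl -IH1 -IH2 -intrD.
  rewrite /binet !expr0z !expr1z /phi /psi; split; first by rewrite /=; field.
  by rewrite /=; field.
case: t => n; first exact: fib_nat_binet.
rewrite NegzE fibN binetN // rmorphM rmorphXz ?unitrN1 //.
rewrite rmorphN1 [X in _ * X](fib_nat_binet n.+1).
(* [fibN] gives the sign [(-1) ^ (t - 1)] and [binetN] at [e = -1] gives [- (-1) ^ t]; they
   agree. *)
by rewrite expfzDr ?oppr_eq0 ?oner_eq0 // exprN1 invrN1; ring.
Qed.

(** * Odd powers and binomial sums of Binet forms *)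

Lemma involution_expr_odd (R : pzRingType) (e : R) (k : nat) :
  e * e = 1 -> e ^+ (2 * k + 1) = e.
Proof. by move=> ee; rewrite exprD exprM expr2 ee expr1n mul1r. Qed.

(** In [exprD_odd] with [x = phi ^ t] and [y = e * psi ^ t], odd powers of [e] equal [e], so each
    bracket is again a Binet form. *)
Lemma binetX (e : algC) (t : int) (m : nat) : e * e = 1 ->
  binet e t ^+ (2 * m + 1) =
  \sum_(i < m.+1) 'C(2 * m + 1, i)%:R * (e * (-1) ^ t) ^+ i *
    binet e ((2 * m%:Z + 1 - 2 * i%:Z) * t).
Proof.
move=> ee; rewrite exprD_odd; apply: eq_bigr => -[i /= lt_im] _.
have -> : phi ^ t * (e * psi ^ t) = e * (-1) ^ t.
  by rewrite mulrCA -expfzMl phi_psi.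
have -> : (2 * m + 1 - 2 * i = 2 * (m - i) + 1)%N by lia.
rewrite !exprMn (involution_expr_odd _ _ _ ee).
have -> : 2 * m%:Z + 1 - 2 * i%:Z = (2 * (m - i) + 1)%N :> int by lia.
by rewrite /binet ![_%:Z * t]mulrC -!exprz_exp -!exprnP.
Qed.

Lemma sum_binet (e d : algC) (N c : int) (n : nat) : d = (-1) ^ N ->
  \sum_(k < n.+1) 'C(n, k)%:R * binet e (2 * N * k%:Z + c) =
  binet d N ^+ n * binet (e * d ^+ n) (N * n%:Z + c).
Proof.
move=> dE; have dd : d * d = 1 by rewrite dE signz_sqr.
have geom (x : algC) : x != 0 ->
    \sum_(k < n.+1) 'C(n, k)%:R * x ^ (2 * N * k%:Z + c) =
    x ^ (N * n%:Z + c) * (x ^ N + x ^ (- N)) ^+ n.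
  move=> x0; rewrite [x ^ N + _]addrC exprDn mulr_sumr; apply: eq_bigr => -[k /= lt_kn] _.
  rewrite -[in RHS]mulr_natl !(mulrCA _ (_%:R)) !exprnP !exprz_exp -!expfzDr //; congr (_ * x ^ _).
  (* The exponents match because [Nn + c - N(n-k) + Nk = 2Nk + c]. *)
  by rewrite -subzn //; ring.
under eq_bigr do rewrite /binet mulrDr [_ * (e * _)]mulrCA.
rewrite big_split /= -mulr_sumr !geom ?phi_neq0 ?psi_neq0 // phiN psiN -dE.
(* For [phi] the base is [binet d N] itself; for [psi] it is [d] times that, which puts the factor
   [d ^+ n] next to [e]. *)
have -> : psi ^ N + d * phi ^ N = d * binet d N by rewrite /binet mulrDr mulrA dd; ring.
rewrite exprMn -/(binet d N) /binet; ring.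
Qed.

(** After the two sums are exchanged, [sum_binet] applies for each [i]. The sign from [binetX] does
    not depend on [k], and [2m+1-2i] is odd, so [d] does not depend on [i]. *)
Lemma sum_binetX (e : algC) (m n : nat) (j r s : int) : e * e = 1 ->
  \sum_(k < n.+1) 'C(n, k)%:R *
     binet e (j * (2 * r * k%:Z + s)) ^+ (2 * m + 1) =
  \sum_(i < m.+1) (e * (-1) ^ (j * s)) ^+ i * 'C(2 * m + 1, i)%:R *
    binet ((-1) ^ (j * r)) ((2 * m%:Z + 1 - 2 * i%:Z) * (j * r)) ^+ n *
    binet (e * ((-1) ^ (j * r)) ^+ n)
      ((2 * m%:Z + 1 - 2 * i%:Z) * (j * r * n%:Z + j * s)).
Proof.
move=> ee; under eq_bigr do rewrite binetX // mulr_sumr.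
rewrite exchange_big; apply: eq_bigr => -[i /= lt_im] _.
set M : int := 2 * m%:Z + 1 - 2 * i%:Z.
have sgnM : (-1) ^ (M * (j * r)) = (-1) ^ (j * r) :> algC.
  have -> : M * (j * r) = 2 * ((m%:Z - i%:Z) * (j * r)) + j * r by rewrite /M; ring.
  by rewrite signz_evenD.
have -> : M * (j * r * n%:Z + j * s) = M * (j * r) * n%:Z + M * (j * s) by ring.
rewrite -[RHS]mulrA -(sum_binet e _ _ _ _ (esym sgnM)) mulr_sumr.
apply: eq_bigr => k _.
have -> : (-1) ^ (j * (2 * r * k%:Z + s)) = (-1) ^ (j * s) :> algC.
  have -> : j * (2 * r * k%:Z + s) = 2 * (j * r * k%:Z) + j * s by ring.
  by rewrite signz_evenD.
have -> : M * (j * (2 * r * k%:Z + s)) = 2 * (M * (j * r)) * k%:Z + M * (j * s) by ring.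
by ring.
Qed.

Lemma sqrt5_exp (k : nat) : sqrtC 5 ^+ (2 * k) = 5 ^+ k :> algC.
Proof. by rewrite exprM sqrtCK. Qed.

Lemma sum_lucasX (m n : nat) (j r s : int) :
  \sum_(k < n.+1) 'C(n, k)%:R *
     (lucas (j * (2 * r * k%:Z + s)))%:~R ^+ (2 * m + 1) =
  \sum_(i < m.+1) (-1) ^ (i%:Z * (j * s)) * 'C(2 * m + 1, i)%:R *
    binet ((-1) ^ (j * r)) ((2 * m%:Z + 1 - 2 * i%:Z) * (j * r)) ^+ n *
    binet (((-1) ^ (j * r)) ^+ n)
      ((2 * m%:Z + 1 - 2 * i%:Z) * (j * r * n%:Z + j * s)).
Proof.
under eq_bigr do rewrite lucas_binet.
rewrite sum_binetX ?mulr1 //; apply: eq_bigr => i _.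
rewrite !mul1r; congr (_ * _ * _ * _).
by rewrite exprnP exprz_exp mulrC.
Qed.

Lemma sum_fibX (m n : nat) (j r s : int) :
  \sum_(k < n.+1) 'C(n, k)%:R *
     (fib (j * (2 * r * k%:Z + s)))%:~R ^+ (2 * m + 1) =
  (5 ^+ m * sqrtC 5)^-1 *
  \sum_(i < m.+1) (-1) ^ (i%:Z * (j * s + 1)) * 'C(2 * m + 1, i)%:R *
    binet ((-1) ^ (j * r)) ((2 * m%:Z + 1 - 2 * i%:Z) * (j * r)) ^+ n *
    binet (- ((-1) ^ (j * r)) ^+ n)
      ((2 * m%:Z + 1 - 2 * i%:Z) * (j * r * n%:Z + j * s)).
Proof.
have -> : (5 ^+ m * sqrtC 5)^-1 = sqrtC 5 ^- (2 * m + 1) :> algC.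
  by rewrite exprD sqrt5_exp expr1.
under eq_bigr do rewrite fib_binet exprMn exprVn mulrA [_ * _^-1]mulrC.
rewrite -mulr_sumr sum_binetX ?mulrNN ?mulr1 //; congr (_ * _).
apply: eq_bigr => i _; rewrite -[- _ ^+ n]mulN1r; congr (_ * _ * _ * _).
(* The coefficient [e = -1] adds one to the exponent [j * s]. *)
rewrite mulrC -[X in _ * X]expr1z -expfzDr ?oppr_eq0 ?oner_eq0 //.
by rewrite exprnP exprz_exp mulrC.
Qed.

(** * Transport from [rat] to [algC] *)

(** The theorem is stated in [rat], while Binet forms live in [algC]. The injective map [ratr] links
    them; it is moved here through the left-hand sides, and next through the right-hand sides. *)
Lemma ratr_sum_binomX (f : int -> int) (n M : nat) (j r s : int) :
  ratr (\sum_(k < n.+1) 'C(n, k)%:R * (f (j * (2 * r * k%:Z + s)))%:~R ^+ M) =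
  \sum_(k < n.+1) 'C(n, k)%:R * (f (j * (2 * r * k%:Z + s)))%:~R ^+ M :> algC.
Proof.
rewrite rmorph_sum; apply: eq_bigr => k _.
by rewrite rmorphM rmorphXn rmorph_nat rmorph_int.
Qed.

Lemma ratr_sum_sign (f g : int -> int) (m n : nat) (a u v : int) (c : rat) :
  ratr (c *
    \sum_(i < m.+1) (-1) ^ (i%:Z * a) * 'C(2 * m + 1, i)%:R *
      (f ((2 * m%:Z + 1 - 2 * i%:Z) * u))%:~R ^+ n *
      (g ((2 * m%:Z + 1 - 2 * i%:Z) * v))%:~R) =
  ratr c * \sum_(i < m.+1) (-1) ^ (i%:Z * a) * 'C(2 * m + 1, i)%:R *
      (f ((2 * m%:Z + 1 - 2 * i%:Z) * u))%:~R ^+ n *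
      (g ((2 * m%:Z + 1 - 2 * i%:Z) * v))%:~R :> algC.
Proof.
rewrite rmorphM rmorph_sum; congr (_ * _); apply: eq_bigr => i _.
by rewrite !rmorphM rmorphXn fmorphXz rmorphN1 rmorph_nat !rmorph_int.
Qed.

Theorem theorem5 (m n : nat) (j r s : int) :
  (\sum_(k < n.+1) 'C(n, k)%:R *
     (fib (j * (2 * r * k%:Z + s)))%:~R ^+ (2 * m + 1) : rat) =
    (if (2 %| j * r)%Z then
       5 ^ (- m%:Z) *
       \sum_(i < m.+1)
         (-1) ^ (i%:Z * (j * s + 1)) * 'C(2 * m + 1, i)%:R *
         (lucas ((2 * m%:Z + 1 - 2 * i%:Z) * (j * r)))%:~R ^+ n *
         (fib ((2 * m%:Z + 1 - 2 * i%:Z) * (j * r * n%:Z + j * s)))%:~R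
     else if ~~ odd n then
       5 ^ ((n %/ 2)%:Z - m%:Z) *
       \sum_(i < m.+1)
         (-1) ^ (i%:Z * (j * s + 1)) * 'C(2 * m + 1, i)%:R *
         (fib ((2 * m%:Z + 1 - 2 * i%:Z) * (j * r)))%:~R ^+ n *
         (fib ((2 * m%:Z + 1 - 2 * i%:Z) * (j * r * n%:Z + j * s)))%:~R
     else
       5 ^ (((n - 1) %/ 2)%:Z - m%:Z) *
       \sum_(i < m.+1)
         (-1) ^ (i%:Z * (j * s + 1)) * 'C(2 * m + 1, i)%:R *
         (fib ((2 * m%:Z + 1 - 2 * i%:Z) * (j * r)))%:~R ^+ n *
         (lucas ((2 * m%:Z + 1 - 2 * i%:Z) * (j * r * n%:Z + j * s)))%:~R)
  /\
  (\sum_(k < n.+1) 'C(n, k)%:R *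
     (lucas (j * (2 * r * k%:Z + s)))%:~R ^+ (2 * m + 1) : rat) =
    (if (2 %| j * r)%Z then
       \sum_(i < m.+1)
         (-1) ^ (i%:Z * (j * s)) * 'C(2 * m + 1, i)%:R *
         (lucas ((2 * m%:Z + 1 - 2 * i%:Z) * (j * r)))%:~R ^+ n *
         (lucas ((2 * m%:Z + 1 - 2 * i%:Z) * (j * r * n%:Z + j * s)))%:~R
     else if ~~ odd n then
       5 ^+ (n %/ 2) *
       \sum_(i < m.+1)
         (-1) ^ (i%:Z * (j * s)) * 'C(2 * m + 1, i)%:R *
         (fib ((2 * m%:Z + 1 - 2 * i%:Z) * (j * r)))%:~R ^+ n *
         (lucas ((2 * m%:Z + 1 - 2 * i%:Z) * (j * r * n%:Z + j * s)))%:~R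
     else
       5 ^+ ((n + 1) %/ 2) *
       \sum_(i < m.+1)
         (-1) ^ (i%:Z * (j * s)) * 'C(2 * m + 1, i)%:R *
         (fib ((2 * m%:Z + 1 - 2 * i%:Z) * (j * r)))%:~R ^+ n *
         (fib ((2 * m%:Z + 1 - 2 * i%:Z) * (j * r * n%:Z + j * s)))%:~R).
Proof.
have q0 := sqrt5_neq0; have qq : sqrtC 5 ^+ 2 = 5 :> algC := sqrtCK _.
have five0 k : 5 ^+ k != 0 :> algC by rewrite expf_neq0 ?pnatr_eq0.
have N1even h : (-1) ^+ (2 * h) = 1 :> algC by rewrite exprM sqrrN !expr1n.
have sgn : (-1) ^ (j * r) = _ :> algC := signz_parity _ _.
have ratr_inj : injective (@ratr algC) by exact: fmorph_inj.
split; apply: ratr_inj.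
- rewrite (ratr_sum_binomX fib) sum_fibX.
  (* Once [(-1) ^ (j * r)] is 1 or -1 and the parity of [n] is known, each form is a Lucas number or
     [sqrtC 5] times a Fibonacci number; only powers of [sqrtC 5] remain to be compared. *)
  rewrite sgn; case: ifP => _; last case: ifP => n_parity.
  + rewrite ratr_sum_sign !mulr_sumr; apply: eq_bigr => i _.
    rewrite expr1n lucas_binet fib_binet fmorphXz rmorph_nat -exprnN.
    by field; rewrite q0 five0.
  + have -> : n = (2 * (n %/ 2))%N by lia.
    move: (n %/ 2)%N => h; rewrite mulKn //.
    rewrite ratr_sum_sign !mulr_sumr; apply: eq_bigr => i _.
    rewrite N1even !fib_binet fmorphXz rmorph_nat expfzDr ?pnatr_eq0 // -exprnN.
    rewrite -exprnP [(_ / sqrtC 5) ^+ _]exprMn exprVn sqrt5_exp.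
    by field; rewrite q0 !five0.
  (* Here [(-1) ^+ n = -1] turns the last factor from Fibonacci to Lucas; the odd [sqrtC 5] from the
     [n]-th power cancels the one in the prefactor. *)
  + have -> : n = (2 * (n %/ 2) + 1)%N by lia.
    move: (n %/ 2)%N => h; rewrite addnK mulKn //.
    rewrite ratr_sum_sign !mulr_sumr; apply: eq_bigr => i _.
    rewrite [(-1) ^+ _]exprD N1even mul1r expr1 opprK fib_binet lucas_binet.
    rewrite fmorphXz rmorph_nat expfzDr ?pnatr_eq0 // -exprnN -exprnP.
    rewrite [(_ / sqrtC 5) ^+ _]exprMn exprVn [sqrtC 5 ^+ _]exprD sqrt5_exp expr1.
    by field; rewrite q0 !five0.
- rewrite (ratr_sum_binomX lucas) sum_lucasX.
  rewrite sgn; case: ifP => _; last case: ifP => n_parity.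
  (* The factor 1 gives the sum the shape that [ratr_sum_sign] expects. *)
  + rewrite -[X in ratr X]mul1r ratr_sum_sign rmorph1 mul1r; apply: eq_bigr => i _.
    by rewrite expr1n !lucas_binet.
  + have -> : n = (2 * (n %/ 2))%N by lia.
    move: (n %/ 2)%N => h; rewrite mulKn //.
    rewrite ratr_sum_sign !mulr_sumr; apply: eq_bigr => i _.
    rewrite N1even fib_binet lucas_binet rmorphXn rmorph_nat.
    rewrite [(_ / sqrtC 5) ^+ _]exprMn exprVn sqrt5_exp.
    by field; rewrite five0.
  + have -> : n = (2 * (n %/ 2) + 1)%N by lia.
    move: (n %/ 2)%N => h.
    have -> : ((2 * h + 1 + 1) %/ 2 = h.+1)%N by lia.
    rewrite ratr_sum_sign !mulr_sumr; apply: eq_bigr => i _.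
    rewrite [(-1) ^+ _]exprD N1even mul1r expr1 !fib_binet.
    rewrite rmorphXn rmorph_nat exprSr.
    rewrite [(_ / sqrtC 5) ^+ _]exprMn exprVn [sqrtC 5 ^+ (_ + _)]exprD sqrt5_exp expr1.
    (* The [sqrtC 5] left from the odd power and the one from the last Fibonacci factor multiply to
       5, hence the exponent [h.+1]. *)
    by field: qq; rewrite q0 five0.
Qed.
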